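(* Let $X,Y$ be compact Hausdorff spaces and $E$ a unital Banach algebra with unit $e_0$. Let $H:C(X,E)\to C(Y,E)$ be a pointwise subadditive separating map such that $\|H1_{e_0}(y)\|\ne0$ for all $y\in Y$. Then for every $y\in Y$ the set $\operatorname{supp}(\hat y\circ H)$ is a singleton.
   Context: $C(X,E)$ is the space of continuous functions $X\to E$ with the supremum norm. For $f\in C(X,E)$, $\operatorname{coz}(f)=\{x\in X:f(x)\ne0\}$. For $e\in E$, $1_e\in C(X,E)$ is the constant function with value $e$. Maps $H:C(X,E)\to C(Y,E)$ are not assumed linear. $H$ is separating if, for all $f,g\in C(X,E)$, $\|f(x)\|\,\|g(x)\|=0$ for all $x\in X$ implies $\|Hf(y)\|\,\|Hg(y)\|=0$ for all $y\in Y$. $H$ is pointwise subadditive if $\|H(f+g)(y)\|\le\|Hf(y)\|+\|Hg(y)\|$ for all $f,g\in C(X,E)$, $y\in Y$. For $y\in Y$, $\hat y\circ H:C(X,E)\to E$ is $f\mapsto Hf(y)$. An open set $U\subseteq X$ is a vanishing set for $\hat y\circ H$ if for each $f\in C(X,E)$, $\operatorname{coz}(f)\subseteq U$ implies $Hf(y)=0$. The support is $\operatorname{supp}(\hat y\circ H)=X\setminus\bigcup\{V\subseteq X: V\text{ is a vanishing set for }\hat y\circ H\}$. *)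

(* Defs.v *)
From HB Require Import structures.
From mathcomp Require Import all_boot all_order all_algebra.
From mathcomp Require Import all_classical all_reals topology normedtype.
From mathcomp.real_closed Require Import complex.

Set Implicit Arguments.
Unset Strict Implicit.
Unset Printing Implicit Defensive.

Import Order.TTheory GRing.Theory Num.Theory.
Import numFieldNormedType.Exports.

Local Open Scope classical_set_scope.
Local Open Scope ring_scope.

(* A Banach algebra may be real or complex; both cases are covered. *)
Variant scalar_kind := RealScalars | ComplexScalars.

Definition scalars (R : realType) (k : scalar_kind) : numFieldType :=
  match k with
  | RealScalars => R
  | ComplexScalars => R[i]%C
  end.

(* The product and the unit are fields of their own, not those of
   [GRing.Algebra]: in the library the only structures that are both normed
   and rings are the number domains, whose norm is multiplicative, and Hierarchy
   Builder rejects a further join.  [`|bone| = 1] is not imposed. *)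
HB.mixin Record CompleteNormedModule_isUnitalBanachAlgebra (K : numFieldType) E
    & CompleteNormedModule K E := {
  bmul : E -> E -> E;
  bone : E;
  bmulA : associative bmul;
  bmul1x : left_id bone bmul;
  bmulx1 : right_id bone bmul;
  bmulDl : left_distributive bmul +%R;
  bmulDr : right_distributive bmul +%R;
  bscaleAl : forall (a : K) (x y : E), a *: bmul x y = bmul (a *: x) y;
  bscaleAr : forall (a : K) (x y : E), a *: bmul x y = bmul x (a *: y);
  normr_bmul : forall x y : E, `|bmul x y| <= `|x| * `|y|
}.

#[short(type="unitalBanachAlgType")]
HB.structure Definition UnitalBanachAlgebra (K : numFieldType) :=
  {E of CompleteNormedModule K E
   & CompleteNormedModule_isUnitalBanachAlgebra K E}.

Section continuous_add.
Context {X : topologicalType} {K : numFieldType} {E : normedModType K}.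
Context (f g : continuousType X E).

Local Lemma cts_add : continuous (f \+ g).
Proof. by move=> x; apply: cvgD; exact: cts_fun. Qed.

HB.instance Definition _ := @isContinuous.Build X E (f \+ g) cts_add.

End continuous_add.

Section support.
Context {K : numFieldType} {X : topologicalType} {E : normedModType K}.

Definition coz (f : continuousType X E) : set X := [set x | f x != 0].

Definition vanishing_set (phi : continuousType X E -> E) (U : set X) : Prop :=
  open U /\ forall f : continuousType X E, coz f `<=` U -> phi f = 0.

Definition supp (phi : continuousType X E -> E) : set X :=
  ~` \bigcup_(V in vanishing_set phi) V.

End support.

Section maps.
Context {K : numFieldType} {X Y : topologicalType} {E : normedModType K}.

Definition evaluation (y : Y) (g : continuousType Y E) : E := g y.

Definition separating (H : continuousType X E -> continuousType Y E) : Prop :=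
  forall f g : continuousType X E,
    (forall x, `|f x| * `|g x| = 0) -> forall y, `|H f y| * `|H g y| = 0.

Definition pointwise_subadditive
    (H : continuousType X E -> continuousType Y E) : Prop :=
  forall (f g : continuousType X E) (y : Y),
    `|H (f \+ g) y| <= `|H f y| + `|H g y|.

End maps.

(* Main.v *)
(* Functions with disjoint cozero sets cannot both be nonzero under [H] at [y],
   so by Hausdorffness the support has at most one point.  If it were empty,
   finitely many vanishing sets would cover [X]; cutting [1] up along this cover
   with Urysohn functions, subadditivity would give [H 1 y = 0]. *)
Require Import Defs.
From HB Require Import structures.
From mathcomp Require Import all_boot all_order all_algebra.
From mathcomp Require Import all_classical all_reals topology normedtype.
From mathcomp.real_closed Require Import complex.

Set Implicit Arguments.
Unset Strict Implicit.
Unset Printing Implicit Defensive.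

Import Order.TTheory GRing.Theory Num.Theory.
Import numFieldNormedType.Exports.

Local Open Scope classical_set_scope.
Local Open Scope ring_scope.

Lemma real_complex_continuous (R : realType) :
  continuous (real_complex R : R -> (R[i]%C : numFieldType)).
Proof.
move=> x; apply/cvgrPdist_lt => e e0.
(* A positive element of [R[i]] is real, so the tolerance [e] comes from some [r : R]; the embedding
   is isometric, hence the same [r] serves in [R]. *)
have /complex_realP [r er] : e \is Num.real by exact: gtr0_real.
move: e0; rewrite {}er ltcR => r0.
near=> z; rewrite -rmorphB normc_def /= expr0n addr0 sqrtr_sqr ltcR.
by near: z; exact: cvgr_dist_lt.
Unshelve. all: by end_near. Qed.

Lemma normal_scalars_urysohn (R : realType) (k : scalar_kind)
    (X : topologicalType) (A B : set X) :
  normal_space X -> closed A -> closed B -> A `&` B = set0 ->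
  exists u : X -> scalars R k, [/\ continuous u,
    forall x, A x -> u x = 0 & forall x, B x -> u x = 1].
Proof.
move=> nX cA cB AB0.
have [f [cf _ fA fB]] : exists f : X -> R, [/\ continuous f,
    range f `<=` `[0, 1], f @` A `<=` [set 0] & f @` B `<=` [set 1]].
  by apply/uniform_separatorP; apply: (@normal_separatorP R X).1 => //.
case: k.
  exists f; split=> // x ?; [exact: fA | exact: fB].
exists (real_complex R \o f); split=> [x|x Ax|x Bx] /=.
- by apply: continuous_comp; [exact: cf | exact: real_complex_continuous].
- by rewrite (fA (f x)).
- by rewrite (fB (f x)).
Qed.

Section finite_vanishing_cover.
Context (R : realType) (k : scalar_kind) (X : topologicalType)
  (E : normedModType (scalars R k)) (phi : continuousType X E -> E).
Hypothesis normX : normal_space X.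
Hypothesis phi_subadditive : forall f g : continuousType X E,
  `|phi (f \+ g)| <= `|phi f| + `|phi g|.
Hypothesis vanishing0 : vanishing_set phi set0.

(** Induction on the cover, with [K] and [f] general: [f] splits into a part living in the first set
    [U] and a part living in a smaller closed set that the remaining sets already cover. *)
Lemma finite_vanishing_cover_eq0 (s : seq (set X)) (K : set X)
    (f : continuousType X E) :
  {in s, forall V, vanishing_set phi V} -> closed K ->
  K `<=` \bigcup_(V in [set` s]) V -> coz f `<=` K -> phi f = 0.
Proof.
elim: s K f => [|U s IHs] K f vs cK Ks fK.
  (* With no sets left, [f] is zero. Subadditivity alone does not give [phi 0 = 0], whence the
     hypothesis [vanishing0]. *)
  by apply: vanishing0.2 => x /fK /Ks [V].
set W := \bigcup_(V in [set` s]) V.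
have [oU vU] : vanishing_set phi U by apply: vs; rewrite mem_head.
have {}vs : {in s, forall V, vanishing_set phi V}.
  by move=> V Vs; apply: vs; rewrite in_cons Vs orbT.
have oW : open W by apply: bigcup_open => V /vs[].
have KUW x : K x -> ~ W x -> U x.
  move=> /Ks[V]; rewrite /= in_cons => /orP[/eqP->//|Vs] Vx nWx.
  by case: nWx; exists V.
(* The function [u] below has to be 1 on an open set [P] around [K \ W], not just on [K \ W]: then
   [(1 - u) f] lives in [K \ P], which is closed and inside [W], as the induction requires. *)
have [P [Q [oP oQ KP UQ PQ0]]] : exists P Q, [/\ open P, open Q,
    K `\` W `<=` P, ~` U `<=` Q & P `&` Q = set0].
  apply: (@normal_openP R X).1 => //.
  - by apply: closedI => //; exact: open_closedC.
  - exact: open_closedC.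
  - by apply/seteqP; split=> // x [[Kx nWx] nUx]; exact: nUx (KUW _ Kx nWx).
have [u [cu uU uQ]] : exists u : X -> scalars R k, [/\ continuous u,
    forall x, (~` U) x -> u x = 0 & forall x, (~` Q) x -> u x = 1].
  apply: normal_scalars_urysohn => //; [exact: open_closedC..|].
  by apply/seteqP; split=> // x [/UQ].
have cg : continuous (fun x => u x *: f x).
  by move=> x; apply: cvgZ; [exact: cu | exact: cts_fun].
have ch : continuous (fun x => (1 - u x) *: f x).
  move=> x; apply: cvgZ; last exact: cts_fun.
  by apply: cvgB; [exact: cvg_cst | exact: cu].
pose g : continuousType X E := mkcts cg.
pose h : continuousType X E := mkcts ch.
have -> : f = (g \+ h : continuousType X E).
  by apply/continuousEP => x /=; rewrite -scalerDl addrC subrK scale1r.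
have g0 : phi g = 0.
  apply: vU => x /eqP gx; apply: contrapT => /uU ux; apply: gx.
  by rewrite -[LHS]/(u x *: f x) ux scale0r.
have h0 : phi h = 0.
  apply: (IHs (K `\` P)) => //.
  - by apply: closedI => //; exact: open_closedC.
  - by move=> x [Kx nPx]; apply: contrapT => nWx; apply: nPx; exact: KP.
  - move=> x; rewrite /coz /= -[h x]/((1 - u x) *: f x) scaler_eq0 negb_or.
    move=> /andP[ux fx]; split; first exact: fK.
    move=> Px; move: ux; rewrite uQ ?subrr ?eqxx// => Qx.
    by have : (P `&` Q) x by []; rewrite PQ0.
apply/eqP; rewrite -normr_le0; apply: le_trans (phi_subadditive g h) _.
by rewrite g0 h0 normr0 addr0.
Qed.

Lemma supp_neq0 (f : continuousType X E) :
  compact [set: X] -> phi f != 0 -> supp phi !=set0.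
Proof.
move=> cX; apply: contra_neqP => supp0.
have cov : [set: X] `<=` cover (vanishing_set phi) id.
  by move=> x _; apply: contrapT => nx; apply: supp0; exists x.
(* If [X] is empty, so is [coz f], and [vanishing0] applies; otherwise [x0] serves as base point. *)
have [[x0 _]|noX] := pselect ([set: X] !=set0); last first.
  by apply: vanishing0.2 => x _; apply: noX; exists x.
(* [compact_cover] is only available for pointed spaces. *)
pose pX : ptopologicalType :=
  HB.pack_for ptopologicalType (Topological.sort X) (isPointed.Build _ x0).
have : @compact pX [set: X] := cX.
rewrite compact_cover => /(_ _ _ _ _ cov)[|s vs covs].
  by move=> V [].
apply: (@finite_vanishing_cover_eq0 (finmap.enum_fset s) setT) => //.
by move=> V /vs; rewrite inE.
Qed.

End finite_vanishing_cover.

(** Otherwise [U] would itself be a vanishing set containing [x], which excludes [x] from the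
    support. *)
Lemma supp_open_neq0 (K : numFieldType) (X : topologicalType)
    (E : normedModType K) (phi : continuousType X E -> E) (x : X) (U : set X) :
  supp phi x -> open U -> U x -> exists2 f, coz f `<=` U & phi f != 0.
Proof.
move=> sx oU Ux; apply: contrapT => nf; apply: sx; exists U => //.
by split=> // f fU; apply/eqP/negPn/negP => phif; apply: nf; exists f.
Qed.

Lemma separating_supp_inj (K : numFieldType) (X Y : topologicalType)
    (E : normedModType K) (H : continuousType X E -> continuousType Y E)
    (y : Y) (x x' : X) :
  hausdorff_space X -> separating H ->
  supp (evaluation y \o H) x -> supp (evaluation y \o H) x' -> x = x'.
Proof.
move=> hX sepH sx sx'; apply: contrapT => /eqP xx'.
move: hX; rewrite open_hausdorff => /(_ _ _ xx')[[U V]] /= [Ux Vx'] [oU oV /eqP UV0].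
have [f fU Hf] := supp_open_neq0 sx oU (set_mem Ux).
have [g gV Hg] := supp_open_neq0 sx' oV (set_mem Vx').
have /sepH/(_ y)/eqP : forall z, `|f z| * `|g z| = 0.
  move=> z; apply/eqP; rewrite mulf_eq0 !normr_eq0.
  apply/negPn/negP; rewrite negb_or => /andP[/fU Uz /gV Vz].
  by have : (U `&` V) z by []; rewrite UV0.
by rewrite mulf_eq0 !normr_eq0 (negbTE Hf) (negbTE Hg).
Qed.

Theorem theorem2p6 (R : realType) (k : scalar_kind)
    (X Y : topologicalType) (E : unitalBanachAlgType (scalars R k))
    (X_compact : compact [set: X]) (X_hausdorff : hausdorff_space X)
    (Y_compact : compact [set: Y]) (Y_hausdorff : hausdorff_space Y)
    (H : continuousType X E -> continuousType Y E)
    (H_subadditive : pointwise_subadditive H)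
    (H_separating : separating H)
    (H1_neq0 : forall y : Y, `|H (cst (bone : E)) y| != 0) :
  forall y : Y, exists x : X, supp (evaluation y \o H) = [set x].
Proof.
move=> y.
have vanishing0 : vanishing_set (evaluation y \o H) set0.
  split=> [|f f0]; first exact: open0.
  (* The zero function is separated from every function, in particular from the constant unit; since
     the image of the latter is nonzero at [y], that of the former must be zero there. *)
  have /H_separating/(_ y)/eqP : forall x, `|f x| * `|cst (bone : E) x| = 0.
    move=> x; have /eqP -> : f x == 0 by apply/negPn/negP => /f0.
    by rewrite normr0 mul0r.
  by rewrite mulf_eq0 (negbTE (H1_neq0 y)) orbF normr_eq0 => /eqP.
have [x sx] : supp (evaluation y \o H) !=set0.
  apply: (supp_neq0 _ _ vanishing0 (f := cst bone)) => //.
  - exact: compact_normal.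
  - by move=> f g; exact: H_subadditive.
  - by rewrite -normr_eq0; exact: H1_neq0.
exists x; apply/seteqP; split=> [x' sx'|x' ->//].
exact: separating_supp_inj sx' sx.
Qed.
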